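(* Let $n,L\ge 1$ be integers, let $\epsilon\in\{1,-1\}$, and let $q,\lambda,\mu_1,\dots,\mu_L>0$ satisfy $q^{\epsilon}<1$ and $\mu_i^{\epsilon}<\lambda^{\epsilon}<1$ for all $i$. Suppose the operators $X_\alpha(\mu)$ $(\alpha\in\mathbb{Z}_{\ge 0}^n)$ obey, for all parameters $\lambda,\mu$ with $0<\mu^\epsilon<\lambda^\epsilon<1$ and all $\alpha,\beta\in\mathbb{Z}_{\ge0}^n$, the relation $$X_\alpha(\mu)X_\beta(\lambda)=\sum_{\gamma,\delta\in\mathbb{Z}^n_{\ge 0}}\mathscr{S}(\lambda,\mu)^{\beta,\alpha}_{\gamma,\delta}\,X_\gamma(\lambda)X_\delta(\mu).$$ Suppose further that $X_0(\lambda)$ is invertible and that the following auxiliary condition is satisfied for all $\beta,\gamma\in\mathbb{Z}_{\ge 0}^n$: $$X_{\beta}(\mu)X_0(\lambda)^{-1}X_\gamma(\lambda)=q^{\varphi(\beta,\gamma)}\frac{g_\beta(\mu)\,g_\gamma(\lambda)}{g_{\beta+\gamma}(\mu)}X_{\beta+\gamma}(\mu).$$ Let $m\in\mathbb{Z}_{\ge0}^n$. If the trace $$\mathbb{P}(\sigma_1,\ldots,\sigma_L)=\mathrm{Tr}\bigl(X_{\sigma_1}(\mu_1)\cdots X_{\sigma_L}(\mu_L)\bigr)$$ is convergent for all $(\sigma_1,\ldots,\sigma_L)\in S(m)$ and not identically zero on $S(m)$, then it gives the (unnormalized) steady state probability in the sector $m$ of the discrete time process $|P(t+1)\rangle=T(\lambda|\mu_1,\ldots,\mu_L)|P(t)\rangle$;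 that is, the vector $|\overline P\rangle=\sum_{(\sigma_1,\ldots,\sigma_L)\in S(m)}\mathbb{P}(\sigma_1,\ldots,\sigma_L)\,|\sigma_1,\ldots,\sigma_L\rangle$ is nonzero and satisfies $T(\lambda|\mu_1,\ldots,\mu_L)|\overline P\rangle=|\overline P\rangle$.
   Context: Notation. $(z)_k=\prod_{j=1}^k(1-zq^{j-1})$; $\binom{k}{l}_q=\frac{(q)_k}{(q)_l(q)_{k-l}}$ if $0\le l\le k$ and $0$ otherwise; $\theta(\text{true})=1$, $\theta(\text{false})=0$. For $\alpha,\beta\in\mathbb{Z}^n$: $|\alpha|=\alpha_1+\cdots+\alpha_n$, $\varphi(\alpha,\beta)=\sum_{1\le i<j\le n}\alpha_i\beta_j$. The zero array is denoted $0$. Define $$\Phi_q(\gamma|\beta;\lambda,\mu)=q^{\varphi(\beta-\gamma,\gamma)}\Bigl(\frac{\mu}{\lambda}\Bigr)^{|\gamma|}\frac{(\lambda)_{|\gamma|}(\mu/\lambda)_{|\beta|-|\gamma|}}{(\mu)_{|\beta|}}\prod_{i=1}^n\binom{\beta_i}{\gamma_i}_q$$ (which is $0$ unless $\gamma_i\le\beta_i$ for all $i$), $$\mathscr{S}(\lambda,\mu)^{\gamma,\delta}_{\alpha,\beta}=\theta(\gamma+\delta=\alpha+\beta)\,\Phi_q(\gamma|\beta;\lambda,\mu),\qquad g_\alpha(\mu)=\frac{\mu^{-|\alpha|}(\mu)_{|\alpha|}}{\prod_{i=1}^n(q)_{\alpha_i}}.$$ Let $W=\bigoplus_{\alpha\in\mathbb{Z}_{\ge0}^n}\mathbb{C}|\alpha\rangle$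 and $|\alpha_1,\ldots,\alpha_L\rangle=|\alpha_1\rangle\otimes\cdots\otimes|\alpha_L\rangle\in W^{\otimes L}$. The Markov transfer matrix $T=T(\lambda|\mu_1,\ldots,\mu_L)$ is the linear operator on $W^{\otimes L}$ given by $T|\beta_1,\ldots,\beta_L\rangle=\sum_{\alpha_1,\ldots,\alpha_L}T^{\alpha_1,\ldots,\alpha_L}_{\beta_1,\ldots,\beta_L}|\alpha_1,\ldots,\alpha_L\rangle$, $$T^{\alpha_1,\ldots,\alpha_L}_{\beta_1,\ldots,\beta_L}=\sum_{\gamma_1,\ldots,\gamma_L\in\mathbb{Z}_{\ge0}^n}\ \prod_{i=1}^L\mathscr{S}(\lambda,\mu_i)^{\gamma_i,\alpha_i}_{\gamma_{i-1},\beta_i},\qquad \gamma_0:=\gamma_L$$ (all sums are finite). For $m\in\mathbb{Z}_{\ge0}^n$, $S(m)=\{(\sigma_1,\ldots,\sigma_L)\in(\mathbb{Z}_{\ge0}^n)^L:\sigma_1+\cdots+\sigma_L=m\}$; $T$ preserves the finite-dimensional span (the sector $m$) of the $|\sigma_1,\ldots,\sigma_L\rangle$ with $(\sigma_1,\ldots,\sigma_L)\in S(m)$. A steady state in the sector $m$ is a nonzero vector of that sector fixed by $T$; its coefficients are called (unnormalized) steady state probabilities. Operators and trace: the $X_\alpha(\mu)$ are elements of a unital associative $\mathbb{C}$-algebra $\mathcal{A}$ of operators. $\mathrm{Tr}$ is a linear functional defined on a linear subspace $\mathcal{A}_0\subseteq\mathcal{A}$ (the elements whose trace is convergent), with the usual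 cyclicity: $AB\in\mathcal{A}_0$ if and only if $BA\in\mathcal{A}_0$, and then $\mathrm{Tr}(AB)=\mathrm{Tr}(BA)$. *)

(* Defs.v *)
From HB Require Import structures.
From mathcomp Require Import all_boot all_order all_algebra finmap.
From mathcomp Require Import boolp classical_sets functions cardinality fsbigop.
From mathcomp Require Import reals complex monalg.

Set Implicit Arguments.
Unset Strict Implicit.
Unset Printing Implicit Defensive.

Import Order.TTheory GRing.Theory Num.Theory.

Local Open Scope ring_scope.
Local Open Scope complex_scope.

Notation mindex n := {ffun 'I_n -> nat}.
Notation config L n := {ffun 'I_L -> {ffun 'I_n -> nat}}.

(* W^{(x)L} as the free module on its basis |s_1, ..., s_L>; the basis vector
   of s is << s >>, and v@_s is the coefficient of v on it. *)
Notation tensor_space R L n := {malg R[i][config L n]}.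

Section Weights.
Variable R : realType.
Implicit Types q z lam mu : R.

Definition qpoch q z (k : nat) : R := \prod_(1 <= j < k.+1) (1 - z * q ^+ j.-1).

Definition qbinom q (k l : nat) : R :=
  if (l <= k)%N then qpoch q q k / (qpoch q q l * qpoch q q (k - l)) else 0.

Variable n : nat.
Implicit Types a b c d : mindex n.

Definition mweight a : nat := (\sum_(i < n) a i)%N.

Definition phi (u v : 'I_n -> int) : int :=
  \sum_(i < n) \sum_(j < n | (i < j)%N) u i * v j.

(* The truncated difference mweight b - mweight c is harmless: if
   mweight c > mweight b, one of the q-binomials vanishes. *)
Definition Phi q c b lam mu : R :=
  q ^ phi (fun i => (b i)%:Z - (c i)%:Z) (fun i => (c i)%:Z)
  * (mu / lam) ^+ mweight c
  * (qpoch q lam (mweight c) * qpoch q (mu / lam) (mweight b - mweight c)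
     / qpoch q mu (mweight b))
  * \prod_(i < n) qbinom q (b i) (c i).

(* Upper indices (c, d) first, then lower indices (a, b). *)
Definition Smx q lam mu c d a b : R := (c + d == a + b)%:R * Phi q c b lam mu.

Definition gcoef q a mu : R :=
  mu ^- mweight a * qpoch q mu (mweight a) / \prod_(i < n) qpoch q q (a i).

Variable L : nat.

(* Upper index s, lower index t. Site i here is site i + 1 of the chain, c i
   is gamma_(i + 1), and ord_pred is the cyclic predecessor, so that
   c (ord_pred 0) is gamma_L = gamma_0. All but finitely many summands vanish,
   since Phi q c b lam mu = 0 unless c <= b componentwise. *)
Definition transfer_coef q lam (mu : 'I_L -> R) (s t : config L n) : R :=
  \sum_(c \in [set: config L n])
    \prod_(i < L) Smx q lam (mu i) (c i) (s i) (c (ord_pred i)) (t i).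

Definition transfer_basis q lam (mu : 'I_L -> R) (t : config L n) :
    tensor_space R L n :=
  \sum_(s \in [set: config L n]) << (transfer_coef q lam mu s t)%:C *g s >>.

Definition transfer q lam (mu : 'I_L -> R) (v : tensor_space R L n) :
    tensor_space R L n :=
  \sum_(t <- msupp v) v@_t *: transfer_basis q lam mu t.

Lemma transferEw q lam (mu : 'I_L -> R) (v : tensor_space R L n)
    (D : {fset config L n}) : (msupp v `<=` D)%fset ->
  transfer q lam mu v = \sum_(t <- D) v@_t *: transfer_basis q lam mu t.
Proof.
move=> sD; rewrite /transfer; apply: big_fset_incl => // t _ tv.
by rewrite mcoeff_outdom ?scale0r.
Qed.

Lemma transfer_is_linear q lam (mu : 'I_L -> R) : linear (transfer q lam mu).
Proof.
move=> k u v; pose D := (msupp u `|` msupp v)%fset.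
have sD : (msupp (k *: u + v) `<=` D)%fset.
  by apply: fsubset_trans (msuppD_le _ _) _; apply: fsetSU; apply: msuppZ_le.
rewrite (transferEw _ _ _ sD) (@transferEw _ _ _ u D) ?fsubsetUl //.
rewrite (@transferEw _ _ _ v D) ?fsubsetUr // scaler_sumr -big_split /=.
by apply: eq_bigr => t _; rewrite mcoeffD mcoeffZ scalerDl scalerA.
Qed.

HB.instance Definition _ q lam (mu : 'I_L -> R) :=
  GRing.isLinear.Build R[i] (tensor_space R L n) (tensor_space R L n) *:%R
    (transfer q lam mu) (transfer_is_linear q lam mu).

Lemma transferU q lam (mu : 'I_L -> R) (t : config L n) :
  transfer q lam mu << t >> = transfer_basis q lam mu t.
Proof.
rewrite (@transferEw _ _ _ _ [fset t]%fset) ?msuppU_le //.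
by rewrite big_seq_fset1 mcoeffUU scale1r.
Qed.

Definition sector_configs (m : mindex n) : set (config L n) :=
  [set s | \sum_(i < L) s i = m]%classic.

Definition in_sector (m : mindex n) (v : tensor_space R L n) : Prop :=
  forall s, s \in msupp v -> sector_configs m s.

Definition steady_state q lam (mu : 'I_L -> R) (m : mindex n)
    (v : tensor_space R L n) : Prop :=
  [/\ in_sector m v, v <> 0 & transfer q lam mu v = v].

End Weights.

(* A0 is the subspace of elements whose trace converges; the values of Tr
   outside A0 are irrelevant. *)
Definition cyclic_trace (R : realType) (A : algType R[i]) (A0 : {pred A})
    (Tr : A -> R[i]) : Prop :=
  [/\ submod_closed A0,
      {in A0 &, forall x y k, Tr (k *: x + y) = k * Tr x + Tr y},
      forall x y, (x * y \in A0) = (y * x \in A0) &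
      forall x y, x * y \in A0 -> Tr (x * y) = Tr (y * x)].

(* The product is noncommutative, and taken in increasing order of sites. *)
Definition matrix_product (R : realType) (A : algType R[i]) (n L : nat)
    (X : mindex n -> R -> A) (mu : 'I_L -> R) (s : config L n) : A :=
  \prod_(i < L) X (s i) (mu i).

(* Main.v *)
(* The auxiliary condition is tuned so that, for [b = s + c],
     Phi q c b lam u *: X b u = Phi q 0 s lam u *: (X s u * X0^-1 * X c lam),
   where X0 = X 0 lam.  In a matrix element of the transfer matrix, once the
   horizontal indices c_i are fixed, conservation at each vertex forces
   t_i = s_i - c_(i-1) + c_i.  So T applied to the trace state is a sum over c
   of traces of prod_i X(s_i - c_(i-1)) X0^-1 X(c_i).  Rotating the trace moves
   X(c_(i-1)) to the left of X(s_i - c_(i-1)), the sum then factorizes over the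
   sites, and each factor is the exchange relation with one index equal to 0:
   it sums to X(s_i) X0 X0^-1 = X(s_i). *)
Require Import Defs.
From HB Require Import structures.
From mathcomp Require Import all_boot all_order all_algebra finmap.
From mathcomp Require Import boolp classical_sets functions cardinality fsbigop.
From mathcomp Require Import reals complex monalg.
From mathcomp Require Import ring.

Set Implicit Arguments.
Unset Strict Implicit.
Unset Printing Implicit Defensive.

Import Order.TTheory GRing.Theory Num.Theory.

Local Open Scope ring_scope.
Local Open Scope complex_scope.

(** * Finitely supported sums and cyclic products *)

(** The bridge from sums over infinite index sets to sums over a finite type, where interchange and
    distributivity are available. The support lies in the image of [f], and injectivity prevents
    double counting. *)
Lemma fsumr_codom (V : nmodType) (I : finType) (J : choiceType) (f : I -> J)
    (D : set J) (F : J -> V) :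
  injective f -> (forall j, D j -> F j != 0 -> exists i, j = f i) ->
  \sum_(j \in D) F j = \sum_(i | f i \in D) F (f i).
Proof.
move=> fI Fsupp; rewrite (fsbigE [seq f i | i <- enum I & f i \in D]) /=.
- rewrite big_map big_filter_cond.
  by rewrite big_enum_cond; apply: eq_bigl => i; rewrite andbb.
- by rewrite map_inj_uniq // filter_uniq // enum_uniq.
- by move=> j /= /mapP[i + ->]; rewrite mem_filter => /andP[+ _]; rewrite inE.
- move=> j Dj; apply: contraNeq => /(Fsupp _ Dj)[i ji].
  by apply/mapP; exists i; rewrite // mem_filter mem_enum -ji andbT; apply/mem_set.
Qed.

Lemma fsumr_only1 (V : nmodType) (J : choiceType) (j0 : J) (D : set J) (F : J -> V) :
  D j0 -> (forall j, D j -> F j != 0 -> j = j0) ->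
  \sum_(j \in D) F j = F j0.
Proof.
move=> Dj0 F0; rewrite (@fsumr_codom _ unit _ (fun=> j0)) /=.
- by rewrite (big_only1 tt) //; apply/mem_set.
- by case; case.
- by move=> j Dj /(F0 _ Dj); exists tt.
Qed.

(** Finiteness of the support matters: a sum over a set with infinite support is 0 by convention. *)
Lemma mcoeff_fsum (K : choiceType) (G : zmodType) (D : set K) (F : K -> G) s :
  finite_set (D `&` [set t | F t != 0])%classic ->
  (\sum_(t \in D) << F t *g t >>)@_s = if s \in D then F s else 0.
Proof.
move=> Dfin.
have -> : \sum_(t \in D) << F t *g t >> =
    \sum_(t \in D `&` [set t | F t != 0]%classic) << F t *g t >>.
  apply/esym/fsbig_widen => [t [] //|t /= [Dt]] nt.
  by apply/eqP; apply: contra_notT nt; rewrite monalgU_eq0.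
rewrite fsbig_finite // raddf_sum /=.
under eq_bigr do rewrite mcoeffU.
case: ifPn => sD; last first.
  rewrite big1_seq // => t /andP[_]; rewrite in_fset_set // inE => -[Dt _].
  by case: eqP => // ts; rewrite -ts (mem_set Dt) in sD.
have [Fs|Fs] := eqVneq (F s) 0.
  by rewrite big1_seq // => t _; case: eqP => // ->; rewrite Fs.
rewrite (bigD1_seq s) ?fset_uniq //=; last first.
  by rewrite in_fset_set // inE; split=> //; rewrite inE in sD.
by rewrite eqxx big1 ?addr0 // => t /negPf->.
Qed.

(** For [L > 0] the first product begins with [a (ord_pred 0) = a ord_max]; this letter is [x], and
    moving it to the far right gives the second product. *)
Lemma prodr_rotate (A : pzSemiRingType) (L : nat) (a b : 'I_L -> A) :
  exists x y, \prod_i (a (ord_pred i) * b i) = x * y /\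
              \prod_i (b i * a i) = y * x.
Proof.
case: L a b => [|l] a b.
  by exists 1, 1; rewrite !big_ord0 mulr1.
(* The alternating word d0 c0 d1 c1 ... dk, paired from the left and from the right. Indexing by
   [nat] keeps ordinal bounds out of the induction. *)
have shift : forall k (c d : nat -> A),
    (\prod_(i < k) (d i * c i)) * d k = d 0%N * \prod_(i < k) (c i * d i.+1).
  elim=> [|k IH] c d; first by rewrite !big_ord0 mulr1 mul1r.
  by rewrite !big_ord_recr /= !mulrA IH.
pose c k := a (inord k); pose d k := b (inord k).
exists (a ord_max), ((\prod_(i < l) (d i * c i)) * d l); split.
  rewrite big_ord_recl shift mulrA; congr (a _ * b _ * _).
  - by apply: val_inj; rewrite /= modn_small.
  - by apply: val_inj; rewrite /= inordK.
  apply: eq_bigr => i _; congr (a _ * b _); apply: val_inj => /=.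
    by rewrite add0n modnDr modn_small ?inordK // ltnS ltnW.
  by rewrite inordK ?ltnS ?ltn_ord.
rewrite big_ord_recr /= -mulrA; congr (_ * _).
  by apply: eq_bigr => i _; congr (b _ * a _); apply: val_inj;
    rewrite /= inordK // ltnS ltnW.
by congr (b _ * _); apply: val_inj; rewrite /= inordK.
Qed.

(** * Bounded multi-indices *)

Section Multiindices.
Variables (n N : nat).

(** A finite type, so that a product over sites of sums over [box] can be expanded into one sum over
    families. *)
Definition box := {ffun 'I_n -> 'I_N.+1}.

Definition box_val (a : box) : mindex n := [ffun k => a k : nat].

Lemma box_val_inj : injective box_val.
Proof.
move=> a b /ffunP ab; apply/ffunP => k; apply: val_inj.
by have := ab k; rewrite !ffunE.
Qed.

Lemma box_valP (a : mindex n) : (forall k, a k <= N)%N -> exists b, a = box_val b.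
Proof.
move=> aN; exists [ffun k => inord (a k)]; apply/ffunP => k.
by rewrite !ffunE inordK ?ltnS.
Qed.

Variable L : nat.

Definition box_config (x : {ffun 'I_L -> box}) : config L n :=
  [ffun i => box_val (x i)].

Lemma box_config_inj : injective box_config.
Proof.
move=> x y /ffunP xy; apply/ffunP => i; apply: box_val_inj.
by have := xy i; rewrite !ffunE.
Qed.

Lemma box_configP (s : config L n) :
  (forall i k, s i k <= N)%N -> exists x, s = box_config x.
Proof.
move=> sN; have /fin_all_exists[f fP] i := box_valP (sN i).
by exists (finfun f); apply/ffunP => i; rewrite !ffunE fP.
Qed.

End Multiindices.

(** * Order and subtraction of multi-indices *)

Section IndexArithmetic.
Variable n : nat.
Implicit Types a b c : mindex n.

Definition idx_le a b := [forall k, (a k <= b k)%N].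
Definition idx_sub a b : mindex n := [ffun k => (a k - b k)%N].

Lemma idx_leP a b : reflect (forall k, (a k <= b k)%N) (idx_le a b).
Proof. exact: forallP. Qed.

Lemma idxDE a b k : (a + b : mindex n) k = (a k + b k)%N.
Proof. by rewrite ffunE. Qed.

Lemma idx_subK a b : idx_le b a -> idx_sub a b + b = a.
Proof. by move=> /idx_leP ba; apply/ffunP => k; rewrite idxDE ffunE subnK. Qed.

Lemma idx_addK a b : idx_sub (a + b) b = a.
Proof. by apply/ffunP => k; rewrite ffunE idxDE addnK. Qed.

Lemma idx_le_addl a b : idx_le b (a + b).
Proof. by apply/idx_leP => k; rewrite idxDE leq_addl. Qed.

Lemma idx_addrI a b c : a + c = b + c -> a = b.
Proof. by move=> abc; rewrite -[a](idx_addK a c) abc idx_addK. Qed.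

Lemma mweightD a b : Defs.mweight (a + b) = (Defs.mweight a + Defs.mweight b)%N.
Proof. by rewrite /Defs.mweight -big_split; apply: eq_bigr => k _; rewrite idxDE. Qed.

Lemma mweight0 : Defs.mweight (0 : mindex n) = 0%N.
Proof. by rewrite /Defs.mweight big1 // => k _; rewrite ffunE. Qed.

Lemma leq_mweight a k : (a k <= Defs.mweight a)%N.
Proof. by rewrite /Defs.mweight (bigD1 k) //= leq_addr. Qed.

Lemma idx_sumE L (s : config L n) k : (\sum_i s i : mindex n) k = (\sum_i s i k)%N.
Proof. by rewrite sum_ffunE. Qed.

Lemma sector_config_leq L (m : mindex n) (s : config L n) i k :
  sector_configs m s -> (s i k <= Defs.mweight m)%N.
Proof.
move=> <-; apply: leq_trans (leq_mweight _ k).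
by rewrite idx_sumE (bigD1 i) //= leq_addr.
Qed.

End IndexArithmetic.

(** * The vertex weights *)

Section WeightIdentities.
Variable (R : realType) (n : nat) (q : R).
Implicit Types (a b c s : mindex n) (lam u : R).

Lemma Phi_eq0 c b lam u : ~~ idx_le c b -> Phi q c b lam u = 0.
Proof.
rewrite negb_forall => /existsP[k kcb].
by rewrite /Phi (bigD1 k) //= /qbinom (negPf kcb) mul0r mulr0.
Qed.

Lemma Smx_eq0 lam u c d a b : ~~ idx_le c b -> Smx q lam u c d a b = 0.
Proof. by move=> /Phi_eq0 Phi0; rewrite /Smx Phi0 mulr0. Qed.

Lemma Smx_neq0 lam u c d a b :
  Smx q lam u c d a b != 0 -> c + d = a + b /\ idx_le c b.
Proof.
have [cb|/Smx_eq0-> //] := boolP (idx_le c b); last by rewrite eqxx.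
by rewrite /Smx; case: (c + d =P a + b) => // _; rewrite mul0r eqxx.
Qed.

Lemma qpoch0 u : qpoch q u 0 = 1.
Proof. by rewrite /qpoch big_geq. Qed.

Lemma qpoch_neq0 u k : (forall j, 1 - u * q ^+ j != 0) -> qpoch q u k != 0.
Proof. by move=> uq; rewrite /qpoch prodf_seq_neq0; apply/allP => j _; apply/implyP. Qed.

(** In the quotient of the [gcoef], the powers combine to (u/lam)^|c|, the products over components
    to the q-binomials, and (u)_|s| cancels the denominator of [Phi q 0 s lam u], whose numerator
    supplies (u/lam)_|s|. *)
Lemma Phi_split s c lam u : lam != 0 -> u != 0 ->
  (forall k, qpoch q q k != 0) -> (forall k, qpoch q u k != 0) ->
  Phi q c (s + c) lam u =
  Phi q 0 s lam u *
  (q ^ phi (fun i => (s i)%:Z) (fun i => (c i)%:Z)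
   * (gcoef q s u * gcoef q c lam / gcoef q (s + c) u)).
Proof.
move=> lam0 u0 qq0 qu0; rewrite /Phi /gcoef mweightD mweight0 addnK subn0 expr0 mulr1.
have -> : phi (fun i => ((s + c)%R i)%:Z - (c i)%:Z) (fun i => (c i)%:Z) =
          phi (fun i => (s i)%:Z) (fun i => (c i)%:Z).
  by apply: eq_bigr => i _; apply: eq_bigr => j _; rewrite idxDE PoszD addrK.
have -> : phi (fun i => (s i)%:Z - ((0%R : mindex n) i)%:Z) (fun i => ((0%R : mindex n) i)%:Z) = 0.
  by apply: big1 => i _; apply: big1 => j _; rewrite !ffunE mulr0.
have -> : \prod_(i < n) qbinom q (s i) ((0%R : mindex n) i) = 1.
  apply: big1 => i _; rewrite ffunE /qbinom subn0.
  by rewrite qpoch0 mul1r divff.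
have -> : \prod_(i < n) qbinom q ((s + c)%R i) (c i) =
    (\prod_(i < n) qpoch q q ((s + c)%R i)) /
    ((\prod_(i < n) qpoch q q (c i)) * \prod_(i < n) qpoch q q (s i)).
  rewrite -big_split /= -prodf_div; apply: eq_bigr => i _.
  by rewrite /qbinom idxDE leq_addl addnK.
rewrite expr0z mul1r mulr1 qpoch0 mul1r.
set Qs := \prod_i qpoch q q (s i); set Qc := \prod_i qpoch q q (c i).
set Qsc := \prod_i qpoch q q _.
have Qs0 : Qs != 0 by apply/prodf_neq0.
have Qc0 : Qc != 0 by apply/prodf_neq0.
have Qsc0 : Qsc != 0 by apply/prodf_neq0.
rewrite expr_div_n !invfM !invrK exprD.
have := qu0 (Defs.mweight s); have := qu0 (Defs.mweight s + Defs.mweight c)%N.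
move: (qpoch q u _) (qpoch q u _) => Us Usc Usc0 Us0.
have us0 : u ^+ Defs.mweight s != 0 by rewrite expf_neq0.
have uc0 : u ^+ Defs.mweight c != 0 by rewrite expf_neq0.
have lc0 : lam ^+ Defs.mweight c != 0 by rewrite expf_neq0.
by field; rewrite us0 lc0 Us0 Usc0 Qs0 Qc0.
Qed.

End WeightIdentities.

(** * The transfer matrix on a sector *)

Section TransferMatrix.
Variables (R : realType) (n L : nat) (q lam : R) (mu : 'I_L -> R).
Implicit Types s t c : config L n.

Let wt s t c : R := \prod_(i < L) Smx q lam (mu i) (c i) (s i) (c (ord_pred i)) (t i).

Lemma transfer_weight_neq0 s t c :
  wt s t c != 0 -> forall i, c i + s i = c (ord_pred i) + t i /\ idx_le (c i) (t i).
Proof. by move=> /prodf_neq0 wt0 i; apply: Smx_neq0 (wt0 i isT). Qed.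

Lemma sum_ord_pred (V : nmodType) (f : 'I_L -> V) :
  \sum_i f (ord_pred i) = \sum_i f i.
Proof. by rewrite [RHS](reindex (@ord_pred L)) //=; apply/onW_bij/ord_pred_bij. Qed.

(** A nonzero weight forces [c i <= t i] componentwise, so the sector of [t] alone bounds [c]; the
    same box serves every [t] in the sector. *)
Lemma transfer_coefE (m : mindex n) s t : sector_configs m t ->
  transfer_coef q lam mu s t =
  \sum_(x : {ffun 'I_L -> box n (Defs.mweight m)}) wt s t (box_config x).
Proof.
move=> mt; rewrite /transfer_coef (fsumr_codom (@box_config_inj n (Defs.mweight m) L)).
  by apply: eq_bigl => x; apply/mem_set.
move=> c _ /transfer_weight_neq0 wc; apply: box_configP => i k.
have [_ /idx_leP ct] := wc i.
by apply: leq_trans (ct k) _; apply: sector_config_leq.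
Qed.

(** Adding the conservation laws of all vertices around the ring, the horizontal indices cancel
    because [ord_pred] permutes the sites. *)
Lemma transfer_coef_sector (m : mindex n) s t : sector_configs m t ->
  transfer_coef q lam mu s t != 0 -> sector_configs m s.
Proof.
move=> mt; rewrite (transfer_coefE s mt) => /eqP sum0.
have [x wx] : exists x, wt s t (@box_config n (Defs.mweight m) L x) != 0.
  apply: contrapT => /forallNP w0; apply: sum0; apply: big1 => x _.
  by apply/eqP/negPn/negP/w0.
move: (box_config x) wx => c /transfer_weight_neq0 wc.
rewrite /sector_configs /= -mt; apply: (@idx_addrI _ _ _ (\sum_i c i)).
rewrite addrC -big_split /= (eq_bigr (fun i => c (ord_pred i) + t i)); last first.
  by move=> i _; case: (wc i).
by rewrite big_split /= sum_ord_pred addrC.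
Qed.

Lemma finite_sector (m : mindex n) : finite_set (@sector_configs n L m).
Proof.
apply: (@sub_finite_set _ _ [set` codom (@box_config n (Defs.mweight m) L)]).
  move=> s ms /=; have [i k|x ->] := @box_configP n (Defs.mweight m) L s.
    exact: sector_config_leq.
  exact: codom_f.
exact: finite_seq.
Qed.

Lemma mcoeff_transfer_basis (m : mindex n) s t : sector_configs m t ->
  (transfer_basis q lam mu t)@_s = (transfer_coef q lam mu s t)%:C.
Proof.
move=> mt; rewrite /transfer_basis mcoeff_fsum ?in_setT //.
apply: sub_finite_set (finite_sector m) => s' [_ /=]; rewrite fmorph_eq0.
exact: transfer_coef_sector.
Qed.

Lemma transfer_sectorE (m : mindex n) (P : config L n -> R[i]) s :
  (transfer q lam mu (\sum_(t \in sector_configs m) << P t *g t >>))@_s =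
  \sum_(t \in sector_configs m) P t * (transfer_coef q lam mu s t)%:C.
Proof.
rewrite !fsbig_finite; try exact: finite_sector.
rewrite linear_sum /= raddf_sum /=; apply: eq_big_seq => t.
rewrite in_fset_set ?inE; last exact: finite_sector.
move=> mt; have -> : << P t *g t >> = P t *: << t >> :> tensor_space R L n.
  by apply/malgP => s'; rewrite mcoeffZ !mcoeffU; case: eqP; rewrite ?mulr1 ?mulr0.
by rewrite linearZ /= transferU mcoeffZ (mcoeff_transfer_basis s mt).
Qed.

End TransferMatrix.

(* Raising [u * q ^+ j = 1] to the power [eps] would make a product of
   factors below 1 equal to 1; this treats both signs of [eps] at once. *)
Lemma qfactor_neq0 (R : realType) (eps : int) (q u : R) j :
  0 < q -> 0 < u -> q ^ eps < 1 -> u ^ eps < 1 -> 1 - u * q ^+ j != 0.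
Proof.
move=> q0 u0 q1 u1; rewrite subr_eq0; apply/eqP => uq1.
suff : (1 : R) < 1 by rewrite ltxx.
rewrite -{1}(exp1rz R eps) {1}uq1 expfzMl exprnP exprzAC -exprnP.
apply: le_lt_trans u1; by rewrite ler_piMr ?exprn_ile1 ?exprz_ge0 ?ltW.
Qed.

(** * Trace identities with control of convergence *)

Section CyclicTrace.
Variables (R : realType) (A : algType R[i]) (A0 : {pred A}) (Tr : A -> R[i]).
Hypothesis Tr_cyclic : cyclic_trace A0 Tr.

Lemma cyclic_trace0 : Tr 0 = 0.
Proof.
have [[A00 _] lin _ _] := Tr_cyclic.
have := lin 0 0 A00 A00 1; rewrite scaler0 addr0 mul1r => T0.
by apply: (@addrI _ (Tr 0)); rewrite addr0 -T0.
Qed.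

Lemma cyclic_traceZ k x : x \in A0 -> k *: x \in A0 /\ Tr (k *: x) = k * Tr x.
Proof.
have [[A00 clos] lin _ _] := Tr_cyclic => xA.
have := lin x 0 xA A00 k; have := clos k x 0 xA A00.
by rewrite !addr0 cyclic_trace0 addr0.
Qed.

Lemma cyclic_trace_sum (I : finType) (P : pred I) (F : I -> A) :
  (forall i, P i -> F i \in A0) -> Tr (\sum_(i | P i) F i) = \sum_(i | P i) Tr (F i).
Proof.
have [[A00 clos] lin _ _] := Tr_cyclic => FA.
(* Linearity is assumed only inside [A0], so membership of the partial sums is carried through the
   induction. *)
suff [] : \sum_(i | P i) F i \in A0 /\
  Tr (\sum_(i | P i) F i) = \sum_(i | P i) Tr (F i) by [].
elim/big_rec2: _ => [|i x y Pi [yA TyE]]; first by rewrite cyclic_trace0.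
have := clos 1 _ _ (FA i Pi) yA; have := lin _ _ (FA i Pi) yA 1.
by rewrite scale1r mul1r TyE.
Qed.

Lemma cyclic_trace_rotate L (a b : 'I_L -> A) :
  \prod_i (b i * a i) \in A0 ->
  \prod_i (a (ord_pred i) * b i) \in A0 /\
  Tr (\prod_i (a (ord_pred i) * b i)) = Tr (\prod_i (b i * a i)).
Proof.
have [_ _ memC trC] := Tr_cyclic.
have [x [y [-> ->]]] := prodr_rotate a b.
by move=> yxA; rewrite memC -(trC _ _ yxA).
Qed.

End CyclicTrace.

(** * One-site consequences of the two operator relations *)

Section ExchangeAlgebra.
Variables (R : realType) (n : nat) (q lam u : R) (A : algType R[i]).
Variables (X : mindex n -> R -> A) (X0inv : A).
Implicit Types a c s : mindex n.

(** Conservation [0 + a = p.1 + p.2] leaves only the pairs [(c, a - c)] with [c <= a]; multiplying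
    on the right by [X0inv] then isolates [X a u]. *)
Lemma exchange_expand N a : X 0 lam * X0inv = 1 ->
  X a u * X 0 lam = \sum_(p \in [set: mindex n * mindex n])
    (Smx q lam u 0 a p.1 p.2)%:C *: (X p.1 lam * X p.2 u) ->
  (forall k, a k <= N)%N ->
  X a u = \sum_(c : box n N | idx_le (box_val c) a)
    (Phi q 0 (idx_sub a (box_val c)) lam u)%:C *:
      (X (box_val c) lam * (X (idx_sub a (box_val c)) u * X0inv)).
Proof.
move=> X0V XaX0 aN; rewrite -[LHS]mulr1 -X0V mulrA XaX0.
pose f (c : box n N) := (box_val c, idx_sub a (box_val c)).
have fI : injective f by move=> c c' [/box_val_inj].
rewrite (fsumr_codom fI); last first.
  move=> [p1 p2] _ /=; rewrite scaler_eq0 negb_or fmorph_eq0 => /andP[S0 _].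
  have [+ _] := Smx_neq0 S0; rewrite add0r => aE.
  have [k|c cE] := @box_valP n N p1.
    by apply: leq_trans (aN k); rewrite aE idxDE leq_addr.
  by exists c; rewrite /f -cE aE addrC idx_addK.
rewrite mulr_suml [RHS]big_mkcond [LHS]big_mkcond /=; apply: eq_bigr => c _.
rewrite (mem_set I); case: ifPn => ca.
  by rewrite /Smx add0r addrC idx_subK // eqxx mul1r -scalerAl mulrA.
(* For a box element [c] not below [a], truncated subtraction breaks [c + (a - c) = a], so the
   conservation delta vanishes. *)
rewrite /Smx add0r; case: eqP => [aE|_]; last by rewrite mul0r scale0r mul0r.
by rewrite aE addrC idx_le_addl in ca.
Qed.

Lemma auxiliary_split c s : lam != 0 -> u != 0 ->
  (forall k, qpoch q q k != 0) -> (forall k, qpoch q u k != 0) ->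
  X s u * X0inv * X c lam =
    (q ^ phi (fun i => (s i)%:Z) (fun i => (c i)%:Z)
     * (gcoef q s u * gcoef q c lam / gcoef q (s + c) u))%:C *: X (s + c) u ->
  (Phi q 0 s lam u)%:C *: (X s u * X0inv * X c lam) =
  (Phi q c (s + c) lam u)%:C *: X (s + c) u.
Proof.
by move=> lam0 u0 qq0 qu0 ->; rewrite scalerA -rmorphM /= -Phi_split.
Qed.

End ExchangeAlgebra.

Theorem proposition6 (R : realType) (n L : nat) (n_gt0 : (0 < n)%N)
  (L_gt0 : (0 < L)%N) (eps : int) (eps_pm1 : eps = 1 \/ eps = -1)
  (q lam : R) (mu : 'I_L -> R)
  (q_gt0 : 0 < q) (lam_gt0 : 0 < lam) (mu_gt0 : forall i, 0 < mu i)
  (q_eps : q ^ eps < 1) (lam_eps : lam ^ eps < 1)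
  (mu_eps : forall i, mu i ^ eps < lam ^ eps)
  (A : algType R[i]) (A0 : {pred A}) (Tr : A -> R[i])
  (Tr_cyclic : cyclic_trace A0 Tr)
  (X : mindex n -> R -> A)
  (X_exchange : forall l u : R, 0 < l -> 0 < u -> u ^ eps < l ^ eps -> l ^ eps < 1 ->
     forall a b : mindex n,
       X a u * X b l =
       \sum_(p \in [set: mindex n * mindex n])
         (Smx q l u b a p.1 p.2)%:C *: (X p.1 l * X p.2 u))
  (X0inv : A) (X0invl : X0inv * X 0 lam = 1) (X0invr : X 0 lam * X0inv = 1)
  (X_aux : forall u : R, 0 < u -> u ^ eps < lam ^ eps ->
     forall b c : mindex n,
       X b u * X0inv * X c lam =
       (q ^ phi (fun i => (b i)%:Z) (fun i => (c i)%:Z)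
        * (gcoef q b u * gcoef q c lam / gcoef q (b + c) u))%:C *: X (b + c) u)
  (m : mindex n)
  (Tr_cvg : forall s : config L n, sector_configs m s ->
     matrix_product X mu s \in A0)
  (Tr_neq0 : exists2 s : config L n, sector_configs m s &
     Tr (matrix_product X mu s) <> 0) :
  steady_state q lam mu m
    (\sum_(s \in sector_configs m) << Tr (matrix_product X mu s) *g s >>).
Proof.
pose P s := Tr (matrix_product X mu s).
have lam0 : lam != 0 by rewrite gt_eqF.
have mu0 i : mu i != 0 by rewrite gt_eqF.
have qq0 k : qpoch q q k != 0.
  by apply: qpoch_neq0 => j; apply: (@qfactor_neq0 _ eps).
have qmu0 i k : qpoch q (mu i) k != 0.
  apply: qpoch_neq0 => j; apply: (@qfactor_neq0 _ eps) => //.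
  exact: lt_trans (mu_eps i) lam_eps.
(* Stationarity, read off at one coefficient [s] of the sector. *)
have stat s : sector_configs m s ->
    \sum_(t \in sector_configs m) P t * (transfer_coef q lam mu s t)%:C = P s.
  move=> ms; set N := Defs.mweight m.
  (* For fixed horizontal indices [c], [tau c] is the only [t] allowed by conservation, and [ok c]
     says that it exists. In [Z c], the word after rotation, site [i] depends on [c] only through
     [c (ord_pred i)]. *)
  pose ok (c : config L n) := [forall i, idx_le (c (ord_pred i)) (s i)].
  pose sg (c : config L n) i := idx_sub (s i) (c (ord_pred i)).
  pose tau (c : config L n) : config L n := [ffun i => sg c i + c i].
  pose phi_tau (c : config L n) := \prod_i Phi q (c i) (sg c i + c i) lam (mu i).
  pose Z (c : config L n) := \prod_i ((Phi q 0 (sg c i) lam (mu i))%:C *: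
    (X (c (ord_pred i)) lam * (X (sg c i) (mu i) * X0inv))).
  have tau_sector (c : config L n) : ok c -> sector_configs m (tau c).
    move=> /forallP okc; rewrite /sector_configs /= -ms.
    under eq_bigr do rewrite ffunE.
    rewrite big_split /= -(sum_ord_pred c) -big_split /=.
    by apply: eq_bigr => i _; rewrite idx_subK.
  have sum_sector (c : config L n) : \sum_(t \in sector_configs m) P t *
      (\prod_(i < L) Smx q lam (mu i) (c i) (s i) (c (ord_pred i)) (t i))%:C =
      if ok c then P (tau c) * (phi_tau c)%:C else 0.
    have supp (t : config L n) : P t * (\prod_(i < L)
        Smx q lam (mu i) (c i) (s i) (c (ord_pred i)) (t i))%:C != 0 ->
        ok c /\ t = tau c.
      rewrite mulf_eq0 negb_or fmorph_eq0 => /andP[_ /transfer_weight_neq0 wc].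
      (* Combine [c i + s i = c (ord_pred i) + t i] with [c i <= t i]. *)
      have okc i k : (c (ord_pred i) k <= s i k)%N.
        have [/ffunP/(_ k) + /idx_leP/(_ k) ct] := wc i.
        by rewrite !idxDE => E; rewrite -(leq_add2l (c i k)) E addnC leq_add2l.
      split; first by apply/forallP => i; apply/idx_leP.
      apply/ffunP => i; rewrite ffunE.
      have [cE _] := wc i; apply: (@idx_addrI _ _ _ (c (ord_pred i))).
      by rewrite [RHS]addrAC idx_subK; [rewrite [RHS]addrC cE addrC | apply/idx_leP].
    case: ifPn => [okc | nokc]; last first.
      by apply: fsbig1 => t _; apply: contraNeq nokc => /supp[].
    rewrite (fsumr_only1 (tau_sector c okc)); last by move=> t _ /supp[].
    congr (_ * _%:C); apply: eq_bigr => i _; rewrite /Smx ffunE.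
    rewrite addrA [_ + sg c i]addrC idx_subK; last exact: (forallP okc).
    by rewrite addrC eqxx mul1r.
  (* The auxiliary condition identifies the word before rotation with a multiple of the matrix
     product at [tau c], whose trace converges by hypothesis; rotation carries both convergence and
     value to [Z c]. *)
  have trZ (c : config L n) : ok c -> Z c \in A0 /\ Tr (Z c) = P (tau c) * (phi_tau c)%:C.
    move=> okc.
    have ZE : \prod_i (((Phi q 0 (sg c i) lam (mu i))%:C *:
        (X (sg c i) (mu i) * X0inv)) * X (c i) lam) =
        (phi_tau c)%:C *: matrix_product X mu (tau c).
      rewrite /phi_tau rmorph_prod -scaler_prod; apply: eq_bigr => i _.
      by rewrite -scalerAl auxiliary_split // ?ffunE //; apply: X_aux.
    have [tauA tauE] := cyclic_traceZ Tr_cyclic (phi_tau c)%:C (Tr_cvg _ (tau_sector c okc)).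
    rewrite -ZE in tauA tauE.
    have [] := cyclic_trace_rotate Tr_cyclic tauA.
    rewrite tauE mulrC; under eq_bigr do rewrite -scalerAr.
    by [].
  have expand : matrix_product X mu s =
      \sum_(x : {ffun 'I_L -> box n N} | ok (box_config x)) Z (box_config x).
    have site i := exchange_expand X0invr
      (X_exchange lam (mu i) lam_gt0 (mu_gt0 i) (mu_eps i) lam_eps (s i) 0)
      (fun k => sector_config_leq i k ms).
    rewrite /matrix_product (eq_bigr _ (fun i _ => site i)).
    rewrite bigA_distr_big_dep /=.
    (* Distributivity labels the summation index of site [i] by [i], while [Z] expects it at
       [ord_pred i]; a cyclic relabelling reconciles the two. *)
    pose shift (x : {ffun 'I_L -> box n N}) := [ffun i => x (ord_pred i)].
    have shift_bij : bijective shift.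
      exists (fun x : {ffun 'I_L -> box n N} => [ffun i => x (ordS i)]) => x; apply/ffunP => i.
        by rewrite !ffunE ordSK.
      by rewrite !ffunE ord_predK.
    rewrite (reindex shift) /=; last exact: onW_bij.
    apply: eq_big => [x | x _].
      apply/familyP/forallP => xs i; have := xs i.
        by rewrite unfold_in /= !ffunE.
      by rewrite unfold_in /= !ffunE.
    by apply: eq_bigr => i _; rewrite /sg !ffunE.
  (* With [t] and [c] both confined to boxes of side [N], the two sums can be exchanged; the sum
     over [t] then gives [Tr (Z c)] for each admissible [c], and these add up to [P s] by
     [expand]. *)
  rewrite (fsumr_codom (@box_config_inj n N L)); last first.
    by move=> t mt _; apply: box_configP => i k; apply: sector_config_leq.
  under eq_bigr => y yS.
    rewrite (transfer_coefE q lam mu s (set_mem yS)) rmorph_sum mulr_sumr; over.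
  rewrite exchange_big /= /P expand (cyclic_trace_sum Tr_cyclic); last first.
    by move=> x /trZ[].
  rewrite [RHS]big_mkcond; apply: eq_bigr => x _.
  have := sum_sector (box_config x).
  rewrite (fsumr_codom (@box_config_inj n N L)) => [-> | t mt _].
    by case: ifP => // /trZ[].
  by apply: box_configP => i k; apply: sector_config_leq.
have coefP s : (\sum_(t \in sector_configs m) << P t *g t >>)@_s =
    if s \in sector_configs m then P s else 0.
  by rewrite mcoeff_fsum //; apply: sub_finite_set (finite_sector L m) => t [].
split.
- move=> s; rewrite -mcoeff_neq0 coefP; case: ifPn => [/set_mem //|_].
  by rewrite eqxx.
- have [s ms Ps] := Tr_neq0 => v0; apply: Ps.
  by have := coefP s; rewrite v0 mcoeff0 (mem_set ms).
- apply/malgP => s; rewrite transfer_sectorE coefP.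
  (* Outside the sector both sides vanish, since [transfer_coef] never leaves the sector of [t]. *)
  case: ifPn => [/set_mem/stat // | ns]; apply: fsbig1 => t mt.
  apply/eqP; apply: contraNT ns; rewrite mulf_eq0 negb_or fmorph_eq0 => /andP[_].
  by move/(transfer_coef_sector mt)/mem_set.
Qed.
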